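(* Let $\mathcal C=\mathcal C(I,A,(\rho_i)_{i\in I},(C^a)_{a\in A})$ be a connected Cartan scheme with $I=\{1,2,3\}$ and $|A|=3$, and let $\mathcal R=\mathcal R(\mathcal C,(R^a)_{a\in A})$ be a finite irreducible root system of type $\mathcal C$. Then $\mathcal R$ is standard, and the Cartan matrices are indecomposable and of type $A_3$, $B_3$ or $C_3$. Moreover, if $c^a_{12}=c^a_{21}=-1$ and $c^a_{13}=c^a_{31}=0$ for all $a\in A$, then there is an enumeration $A=\{x,y,z\}$ such that: in the type $A_3$ case, $\rho_1$ and $\rho_3$ both interchange $x$ and $y$ and fix $z$, while $\rho_2$ interchanges $y$ and $z$ and fixes $x$; in the type $B_3$ and $C_3$ cases, $\rho_1$ interchanges $x$ and $y$ and fixes $z$, $\rho_2$ interchanges $y$ and $z$ and fixes $x$, and $\rho_3$ is the identity.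
   Context: Let $I$ be a nonempty finite set and $\{\alpha_i\mid i\in I\}$ the standard basis of $\mathbb Z^I$; $\mathbb N_0=\{0,1,2,\dots\}$. A generalized Cartan matrix is $C=(c_{ij})_{i,j\in I}\in\mathbb Z^{I\times I}$ with $c_{ii}=2$, $c_{jk}\le0$ for $j\ne k$, and $c_{ij}=0\Rightarrow c_{ji}=0$. A Cartan scheme $\mathcal C=\mathcal C(I,A,(\rho_i)_{i\in I},(C^a)_{a\in A})$ consists of a nonempty set $A$, maps $\rho_i:A\to A$ and generalized Cartan matrices $C^a=(c^a_{jk})_{j,k\in I}$ such that (C1) $\rho_i^2=\mathrm{id}$ and (C2) $c^a_{ij}=c^{\rho_i(a)}_{ij}$ for all $a\in A$, $i,j\in I$. It is connected if the group generated by the $\rho_i$ acts transitively on $A$; it is standard if $C^a=C^b$ for all $a,b\in A$ (a root system is standard if its Cartan scheme is). For $i\in I$, $a\in A$ let $\sigma_i^a\in\mathrm{Aut}(\mathbb Z^I)$, $\sigma_i^a(\alpha_j)=\alpha_j-c^a_{ij}\alpha_i$. A root system of type $\mathcal C$ is a family $\mathcal R=\mathcal R(\mathcal C,(R^a)_{a\in A})$ of subsets $R^a\subset\mathbb Z^I$ such that, writing $R^a_+=R^a\cap\mathbb N_0^I$ and $m^a_{i,j}=|R^a\cap(\mathbb N_0\alpha_i+\mathbb N_0\alpha_j)|$, for all $a\in A$, $i,j\in I$: (R1) $R^a=R^a_+\cup(-R^a_+)$; (R2) $R^a\cap\mathbb Z\alpha_i=\{\alpha_i,-\alpha_i\}$;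 (R3) $\sigma_i^a(R^a)=R^{\rho_i(a)}$; (R4) if $i\neq j$ and $m^a_{i,j}$ is finite then $(\rho_i\rho_j)^{m^a_{i,j}}(a)=a$. It is finite if every $R^a$ is finite. $\mathcal R$ is reducible if there exist nonempty disjoint $I_1,I_2\subset I$ with $I=I_1\cup I_2$ and $R^a=(R^a\cap\sum_{i\in I_1}\mathbb Z\alpha_i)\cup(R^a\cap\sum_{j\in I_2}\mathbb Z\alpha_j)$ for all $a\in A$; otherwise it is irreducible. *)

(* Defs.v *)
From mathcomp Require Import all_boot all_order all_algebra all_fingroup.
Set Implicit Arguments. Unset Strict Implicit. Unset Printing Implicit Defensive.
Import Order.TTheory GRing.Theory Num.Theory.
Local Open Scope ring_scope.

Definition vec (I : finType) := {ffun I -> int}.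

Definition alpha (I : finType) (i : I) : vec I := [ffun j => ((i == j) : nat)%:Z].

Definition gcm (I : finType) (C : I -> I -> int) : Prop :=
  (forall i, C i i = 2) /\
  (forall j k, j != k -> C j k <= 0) /\
  (forall i j, C i j = 0 -> C j i = 0).

Definition cartan_scheme (I : finType) (A : Type) (rho : I -> A -> A)
    (C : A -> I -> I -> int) : Prop :=
  inhabited A /\
  (forall a, gcm (C a)) /\
  (forall i a, rho i (rho i a) = a) /\
  (forall a i j, C a i j = C (rho i a) i j).

(* connected: the group generated by the rho_i acts transitively on A
   (the rho_i are involutions, so words in the rho_i suffice) *)
Definition connected (I : finType) (A : Type) (rho : I -> A -> A) : Prop :=
  forall a b : A, exists w : seq I, foldr (fun i x => rho i x) a w = b.

Definition standard (I : finType) (A : Type) (C : A -> I -> I -> int) : Prop :=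
  forall a b : A, C a = C b.

(* sigma_i^a (alpha_j) = alpha_j - c^a_ij alpha_i, extended Z-linearly *)
Definition sigma (I : finType) (A : Type) (C : A -> I -> I -> int)
    (a : A) (i : I) (v : vec I) : vec I :=
  v - alpha i *~ (\sum_(j : I) C a i j * v j).

Definition nonneg (I : finType) (v : vec I) : Prop := forall i, 0 <= v i.

Definition in_cone (I : finType) (i j : I) (v : vec I) : Prop :=
  exists m n : nat, v = alpha i *+ m + alpha j *+ n.

Definition root_system (I : finType) (A : Type) (rho : I -> A -> A)
    (C : A -> I -> I -> int) (R : A -> vec I -> Prop) : Prop :=
  (forall a v, R a v <-> (R a v /\ nonneg v) \/ (R a (- v) /\ nonneg (- v))) /\
  (forall a i (k : int), R a (alpha i *~ k) <-> (k = 1 \/ k = -1)) /\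
  (forall a i v, R (rho i a) v <-> exists2 w, R a w & sigma C a i w = v) /\
  (* (R4): if m^a_{ij} is finite (enumerated by the duplicate-free list s),
     then (rho_i rho_j)^(m^a_{ij}) (a) = a *)
  (forall a i j, i != j ->
     forall s : seq (vec I), uniq s ->
       (forall v, v \in s <-> (R a v /\ in_cone i j v)) ->
       iter (size s) (fun x => rho i (rho j x)) a = a).

Definition finite_rs (I : finType) (A : Type) (R : A -> vec I -> Prop) : Prop :=
  forall a, exists s : seq (vec I), forall v, R a v <-> v \in s.

Definition supported_in (I : finType) (J : {set I}) (v : vec I) : Prop :=
  forall k, k \notin J -> v k = 0.

Definition reducible (I : finType) (A : Type) (R : A -> vec I -> Prop) : Prop :=
  exists I1 I2 : {set I},
    [/\ I1 != set0, I2 != set0, [disjoint I1 & I2], I1 :|: I2 = setT &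
       forall a v, R a v <->
         ((R a v /\ supported_in I1 v) \/ (R a v /\ supported_in I2 v))].

Definition irreducible (I : finType) (A : Type) (R : A -> vec I -> Prop) : Prop :=
  ~ reducible R.

Definition indecomposable (I : finType) (M : I -> I -> int) : Prop :=
  ~ exists I1 I2 : {set I},
    [/\ I1 != set0, I2 != set0, [disjoint I1 & I2], I1 :|: I2 = setT &
       forall i j, i \in I1 -> j \in I2 -> M i j = 0].

(* Cartan matrices of rank 3, indices 0,1,2 standing for 1,2,3 *)
Definition cm3 (c12 c21 c23 c32 : int) (i j : 'I_3) : int :=
  match nat_of_ord i, nat_of_ord j with
  | O, O => 2 | S O, S O => 2 | S (S O), S (S O) => 2
  | O, S O => c12 | S O, O => c21
  | S O, S (S O) => c23 | S (S O), S O => c32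
  | _, _ => 0
  end.

Definition cmA3 := cm3 (-1) (-1) (-1) (-1).
(* Bourbaki/Kac convention: alpha_3 short in B_3, long in C_3 *)
Definition cmB3 := cm3 (-1) (-1) (-1) (-2).
Definition cmC3 := cm3 (-1) (-1) (-2) (-1).

Definition of_type (X M : 'I_3 -> 'I_3 -> int) : Prop :=
  exists p : {perm 'I_3}, forall i j, M i j = X (p i) (p j).

Definition i1 : 'I_3 := @Ordinal 3 0 isT.
Definition i2 : 'I_3 := @Ordinal 3 1 isT.
Definition i3 : 'I_3 := @Ordinal 3 2 isT.

(* Main.v *)
(** Let V a be the sum of the positive roots at a.  As sigma_i permutes the
    positive roots other than alpha_i, V (rho_i a) = sigma_i (V a) + 2 alpha_i:
    a linear system in positive unknowns whose coefficients are the Cartan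
    entries.  In rank two, consecutive entries 0, or (1, 1), or (1, 2, 1), or
    (2, 1, 2) (up to sign) force m_ij = 2, 3, 4, 4, and (R4) then restricts
    rho_i rho_j.

    By transitivity on three points two of the rho's are distinct
    transpositions, (x y) and (y z).  If the third is (x z), every Cartan entry
    at y is nonzero and adding up the equations for V gives a contradiction; if
    it is one of the first two, the equations force type A3.  If it is the
    identity, a case distinction on the vanishing Cartan entries of the third
    index leaves B3, C3 and decomposable matrices, and the latter make the root
    system reducible. *)
Require Import Defs.
From mathcomp Require Import all_boot all_order all_algebra all_fingroup.
From mathcomp Require Import zify.
From Stdlib Require Import FunctionalExtensionality.
Set Implicit Arguments. Unset Strict Implicit.
Import Order.TTheory GRing.Theory Num.Theory.
Local Open Scope ring_scope.

(** * The sum of the positive roots *)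

Section RootSystem.
Context {I : finType} {A : finType} {rho : I -> A -> A}.
Context {C : A -> I -> I -> int} {R : A -> vec I -> Prop}.
Hypothesis CS : cartan_scheme rho C.
Hypothesis RS : root_system rho C R.

Lemma rhoK i : involutive (rho i).
Proof. by case: CS => _ [_ [h _]]; apply: h. Qed.

Lemma cartan_diag a i : C a i i = 2.
Proof. by case: CS => _ [/(_ a) [h _] _]; apply: h. Qed.

Lemma cartan_le0 a i j : i != j -> C a i j <= 0.
Proof. by case: CS => _ [/(_ a) [_ []]] h _ _; apply: h. Qed.

Lemma cartan_eq0 a i j : C a i j = 0 -> C a j i = 0.
Proof. by case: CS => _ [/(_ a) [_ []]] _ h _; apply: h. Qed.

Lemma cartan_rho i a j : C (rho i a) i j = C a i j.
Proof. by case: CS => _ [_ [_ h]]; rewrite -h. Qed.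

Lemma alphaE (i k : I) : alpha i k = ((i == k) : nat)%:Z.
Proof. by rewrite ffunE. Qed.

Lemma mulrz_ffunE (v : vec I) (m : int) k : (v *~ m) k = v k * m.
Proof.
case: m => n; first by rewrite -pmulrn ffunMnE -mulr_natr natz.
by rewrite NegzE mulrNz ffunE -pmulrn ffunMnE -mulr_natr natz mulrN.
Qed.

Lemma sigmaE a i v k :
  sigma C a i v k = v k - ((i == k) : nat)%:Z * \sum_j C a i j * v j.
Proof. by rewrite !ffunE mulrz_ffunE alphaE. Qed.

Lemma sigmaD a i : {morph sigma C a i : u v / u + v}.
Proof.
move=> u v; apply/ffunP=> k; rewrite [RHS]ffunE !sigmaE ffunE.
under eq_bigr do rewrite ffunE mulrDr.
by rewrite big_split /= mulrDr opprD addrACA.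
Qed.

Lemma sigma0 a i : sigma C a i 0 = 0.
Proof.
apply/ffunP=> k; rewrite sigmaE [RHS]ffunE [X in X - _]ffunE big1 ?mulr0 ?subr0 // => j _.
by rewrite ffunE mulr0.
Qed.

Lemma sigma_alpha a i : sigma C a i (alpha i) = - alpha i.
Proof.
apply/ffunP=> k; rewrite sigmaE [RHS]ffunE (bigD1 i) //= big1; last first.
  by move=> j ji; rewrite alphaE eq_sym (negbTE ji) mulr0.
by rewrite !alphaE eqxx cartan_diag; case: (i == k).
Qed.

Lemma root_sign a v : R a v -> nonneg v \/ nonneg (- v).
Proof. by case: RS => h _ /h [] []; [left | right]. Qed.

Lemma root_alpha_mul a i (k : int) : R a (alpha i *~ k) <-> k = 1 \/ k = -1.
Proof. by case: RS => _ [h _]; apply: h. Qed.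

Lemma root_alpha a i : R a (alpha i).
Proof. by apply/(root_alpha_mul a i 1); left. Qed.

Lemma root_sigma a i v : R a v -> R (rho i a) (sigma C a i v).
Proof. by case: RS => _ [_ [h _]] Rv; apply/h; exists v. Qed.

Lemma sigmaK a i v : sigma C (rho i a) i (sigma C a i v) = v.
Proof.
apply/ffunP=> k; rewrite !sigmaE.
(* The reflection negates the linear form given by row [i]: (C2) keeps that row, and its diagonal
   entry is 2. *)
have -> : \sum_j C (rho i a) i j * sigma C a i v j = - \sum_j C a i j * v j.
  under eq_bigr do rewrite sigmaE cartan_rho mulrBr.
  rewrite big_split /= sumrN; set S := \sum_j _.
  rewrite [X in S - X](bigD1 i) //= [X in S - (_ + X)]big1; last first.
    by move=> j ji; rewrite eq_sym (negbTE ji) mul0r mulr0.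
  by rewrite eqxx cartan_diag; lia.
lia.
Qed.

(** A positive root supported at [i] alone is a multiple of [alpha i], and (R2) leaves only
    [alpha i] itself. *)
Lemma root_off_axis a i v : R a v -> nonneg v -> v != alpha i ->
  exists2 k, k != i & 0 < v k.
Proof.
move=> Rv nv; case: (boolP [exists k, (k != i) && (0 < v k)]).
  by case/existsP=> k /andP[ki vk] _; exists k.
move/existsPn=> h /eqP[].
have ev : v = alpha i *~ v i.
  apply/ffunP=> k; rewrite mulrz_ffunE alphaE; have := h k; have := nv k.
  by case: eqVneq => [->|]; lia.
move: Rv; rewrite ev => /root_alpha_mul; have := nv i.
by case=> h0 [] e; move: h0; rewrite e ?mulr1z.
Qed.

(** The reflection does not touch the positive coordinate off [i], so (R1) makes the whole image
    nonnegative. *)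
Lemma sigma_pos_root a i v : R a v -> nonneg v -> v != alpha i ->
  nonneg (sigma C a i v) /\ sigma C a i v != alpha i.
Proof.
move=> Rv nv vi; have [k ki vk] := root_off_axis Rv nv vi.
have sk : sigma C a i v k = v k by rewrite sigmaE eq_sym (negbTE ki); lia.
split; last by apply/eqP=> e; move: sk; rewrite e alphaE eq_sym (negbTE ki); lia.
case: (root_sign (root_sigma i Rv)) => // /(_ k).
by rewrite ffunE sk; lia.
Qed.

Lemma pos_root_sum : finite_rs R ->
  exists V : A -> vec I, (forall a i, 1 <= V a i) /\
    (forall a i, V (rho i a) = sigma C a i (V a) + alpha i *+ 2).
Proof.
move=> fR.
have {fR} /fin_all_exists [P Pspec] : forall a, exists s : seq (vec I),
    uniq s /\ forall v, v \in s <-> R a v /\ nonneg v.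
  move=> a; have [s hs] := fR a.
  exists (undup [seq v : vec I <- s | [forall i, 0 <= v i]]); split=> [|v].
    exact: undup_uniq.
  rewrite mem_undup mem_filter; split.
    by case/andP=> /forallP nv /hs.
  by case=> /hs -> nv; rewrite andbT; apply/forallP.
have Pa a i : alpha i \in P a.
  have [_ h] := Pspec a; apply/h; split; first exact: root_alpha.
  by move=> k; rewrite alphaE.
have uP a : uniq (P a) by case: (Pspec a).
have PE a v : v \in P a <-> R a v /\ nonneg v by case: (Pspec a).
have sub a i v : v \in rem (alpha i) (P a) -> sigma C a i v \in rem (alpha i) (P (rho i a)).
  rewrite !mem_rem_uniq // !inE => /andP[vi /PE[Rv nv]].
  have [ns ->] := sigma_pos_root Rv nv vi.
  by apply/PE; split=> //; apply: root_sigma.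
(* Injectivity is [sigmaK]; for surjectivity, [sub] at [rho i a] sends [w] back to its preimage. *)
have perm a i : perm_eq [seq sigma C a i v | v <- rem (alpha i) (P a)]
                        (rem (alpha i) (P (rho i a))).
  apply: uniq_perm; rewrite ?rem_uniq //.
    rewrite map_inj_uniq ?rem_uniq //; exact: (can_inj (sigmaK a i)).
  move=> w; apply/mapP/idP=> [[v /sub h ->] //|/sub].
  rewrite rhoK => h; exists (sigma C (rho i a) i w) => //.
  by have := sigmaK (rho i a) i w; rewrite rhoK.
have split a i : \sum_(v <- P a) v = alpha i + \sum_(v <- rem (alpha i) (P a)) v.
  by rewrite (perm_big _ (perm_to_rem (Pa a i))) big_cons.
exists (fun a => \sum_(v <- P a) v); split=> a i.
  rewrite (split a i) ffunE alphaE sum_ffunE eqxx lerDl big_seq sumr_ge0 // => v.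
  by move=> /mem_rem /PE[_]; apply.
(* The reflected old sum contributes [- alpha i] where the new sum contains [alpha i], whence the
   correction by twice [alpha i]. *)
rewrite (split (rho i a) i) -(perm_big _ (perm a i)) big_map.
rewrite (split a i) sigmaD sigma_alpha (big_morph _ (sigmaD a i) (sigma0 a i)).
by rewrite mulr2n (addrC (- _)) -addrA addKr addrC.
Qed.
End RootSystem.

(** * Rank two *)

Section Plane.
Context {I : finType} {A : finType} {rho : I -> A -> A}.
Context {C : A -> I -> I -> int} {R : A -> vec I -> Prop}.
Hypothesis CS : cartan_scheme rho C.
Hypothesis RS : root_system rho C R.
Variables (i j : I).
Hypothesis ij : i != j.

(** Coordinates are integers, so that reflected vectors can be written down before their signs are
    known. *)
Definition plane_root (a : A) (u w : int) : Prop :=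
  R a (alpha i *~ u + alpha j *~ w).

Lemma planeE u w k :
  (alpha i *~ u + alpha j *~ w) k = ((i == k) : nat)%:Z * u + ((j == k) : nat)%:Z * w.
Proof. by rewrite ffunE !mulrz_ffunE !alphaE. Qed.

Lemma planeEl u w : (alpha i *~ u + alpha j *~ w) i = u.
Proof. by rewrite planeE eqxx eq_sym (negbTE ij); lia. Qed.

Lemma planeEr u w : (alpha i *~ u + alpha j *~ w) j = w.
Proof. by rewrite planeE eqxx (negbTE ij); lia. Qed.

Lemma plane_sign a u w : plane_root a u w -> 0 <= u /\ 0 <= w \/ u <= 0 /\ w <= 0.
Proof.
case/(root_sign RS)=> h; have := h i; have := h j.
  by rewrite planeEl planeEr; left.
by rewrite ffunE planeEr ffunE planeEl; right; lia.
Qed.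

Lemma sum_plane (c : I -> int) u w :
  \sum_k c k * (alpha i *~ u + alpha j *~ w) k = c i * u + c j * w.
Proof.
rewrite (bigD1 i) //= (bigD1 j) 1?eq_sym //= planeEl planeEr big1 ?addr0 // => k.
by case/andP=> ki kj; rewrite planeE ![_ == k]eq_sym (negbTE ki) (negbTE kj); lia.
Qed.

Lemma plane_root_sigma a u w :
  plane_root a u w -> plane_root (rho i a) (- C a i j * w - u) w.
Proof.
move=> /(root_sigma RS i); rewrite /plane_root; congr R; apply/ffunP=> k.
by rewrite sigmaE sum_plane !planeE (cartan_diag CS); case: eqVneq; lia.
Qed.

Lemma plane_root_axis a u : plane_root a u 0 -> u = 1 \/ u = -1.
Proof. by rewrite /plane_root mulr0z addr0 => /(root_alpha_mul RS). Qed.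

Lemma plane_root10 a : plane_root a 1 0.
Proof. by rewrite /plane_root mulr0z addr0; apply: root_alpha RS _ _. Qed.

(** This is (R4) in coordinates: for distinct [i] and [j] the pairs in [l] correspond bijectively to
    the roots in the cone, so [size l] is $m_{ij}$. *)
Lemma plane_rho_iter a (l : seq (nat * nat)) : uniq l ->
  (forall u w : nat, plane_root a u w <-> (u, w) \in l) ->
  iter (size l) (fun x => rho i (rho j x)) a = a.
Proof.
move=> ul hl; pose f (p : nat * nat) : vec I := alpha i *~ p.1 + alpha j *~ p.2.
have f_inj : injective f.
  case=> u w [u' w'] e; have := congr1 (fun v : vec I => (v i, v j)) e.
  by rewrite /f /= !planeEl !planeEr => -[-> ->].
have [_ [_ [_ R4]]] := RS.
rewrite -(size_map f); apply: (R4 a i j ij); first by rewrite map_inj_uniq.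
move=> v; split.
  case/mapP=> -[u w] /hl Ruw ->; split=> //; exists u, w; by rewrite /f /= -!pmulrn.
case=> Rv [u [w e]]; apply/mapP; exists (u, w); last by rewrite e /f /= -!pmulrn.
by apply/hl; rewrite /plane_root -!pmulrn -e.
Qed.
End Plane.

Section RankTwo.
Context {I : finType} {A : finType} {rho : I -> A -> A}.
Context {C : A -> I -> I -> int} {R : A -> vec I -> Prop}.
Hypothesis CS : cartan_scheme rho C.
Hypothesis RS : root_system rho C R.
Let plane := @plane_root I A R.

Lemma plane_rootC (i j : I) a u w : plane i j a u w -> plane j i a w u.
Proof. by rewrite /plane /plane_root addrC. Qed.

Variables (i j : I).
Hypothesis ij : i != j.
Let ji : j != i. Proof. by rewrite eq_sym. Qed.

Lemma plane_root_sigmaC a u w :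
  plane i j a u w -> plane i j (rho j a) u (- C a j i * u - w).
Proof. by move=> /plane_rootC /(plane_root_sigma CS RS ji)/plane_rootC. Qed.

Lemma plane_root01 a : plane i j a 0 1.
Proof. exact: plane_rootC (plane_root10 RS j i a). Qed.

Lemma plane_root_axisC a w : plane i j a 0 w -> w = 1 \/ w = -1.
Proof. by move=> /plane_rootC/(plane_root_axis RS). Qed.

Lemma cartan_nz a k l : C a k l != 0 -> C a l k != 0.
Proof. by apply: contra_neq; apply: cartan_eq0 CS _ _ _. Qed.

(** The reflection along [i] sends [(u, w)] to [(- u, w)], so by (R1) no root has two positive
    coordinates. *)
Lemma rho_iter2 a : C a i j = 0 -> iter 2 (fun x => rho i (rho j x)) a = a.
Proof.
move=> c0; apply: (plane_rho_iter RS ij (l := [:: (1, 0); (0, 1)]%N)) => // u w.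
rewrite !inE !xpair_eqE; split.
  move=> Ruw; have := plane_sign RS ij (plane_root_sigma CS RS ij Ruw).
  rewrite c0; case: w Ruw => [|w] Ruw.
    by have := plane_root_axis RS Ruw; lia.
  case: u Ruw => [|u] Ruw; last by lia.
  by have := plane_root_axisC Ruw; lia.
case/orP=> /andP[/eqP-> /eqP->]; [exact: (plane_root10 RS) | exact: plane_root01].
Qed.

(** Put [k = - C (rho j a) i j]. The root [(k, 1)] at [rho j a], reflected along [j] and then [i],
    becomes [(-1, k - 1)], so (R1) gives [k <= 1]; and [k] is nonzero because the transposed entry
    is. *)
Lemma cartan_adj_ones a : C a i j = -1 -> C a j i = -1 -> C (rho j a) i j = -1.
Proof.
move=> cij cji; set b := rho j a.
have bE : rho j b = a by rewrite /b (rhoK CS).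
have bji : C b j i = -1 by rewrite (cartan_rho CS).
have := plane_root_sigma CS RS ij (plane_root01 (rho i b)).
rewrite (rhoK CS) (cartan_rho CS) => /plane_root_sigmaC.
rewrite bE bji => /(plane_root_sigma CS RS ij)/(plane_sign RS ij); rewrite cij.
have := cartan_le0 CS b ij; have /cartan_nz : C b j i != 0 by rewrite bji.
lia.
Qed.

Lemma cartan_adj_prod2 a x y : C a i j = - x -> C a j i = - y ->
  C (rho i a) j i = - y -> x * y = 2 -> C (rho j a) i j = - x.
Proof.
move=> cij cji cji' xy; set b := rho j a.
have bE : rho j b = a by rewrite /b (rhoK CS).
have bji : C b j i = - y by rewrite (cartan_rho CS).
(* Reflecting [- alpha j] at [rho i a] along [i], [j], [i] gives [(x + C b i j, -1)], whose first
   coordinate (R1) bounds by 0. *)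
have : x <= - C b i j.
  have h : plane i j b (- x) (-1).
    have := plane_root_sigmaC (plane_root01 (rho j (rho i a))).
    rewrite (rhoK CS) (cartan_rho CS) mulr0 sub0r => /(plane_root_sigma CS RS ij).
    rewrite (rhoK CS) (cartan_rho CS) cij => /plane_root_sigmaC; rewrite -/b cji.
    by congr plane; lia.
  by have := plane_sign RS ij (plane_root_sigma CS RS ij h); lia.
(* With [k = - C b i j], the root [(k, 1)] at [b] reflected along [j], [i], [j] ends at
   [(k - x, -1)], because [x * y = 2]. *)
have : - C b i j <= x.
  have := plane_root_sigma CS RS ij (plane_root01 (rho i b)).
  rewrite (rhoK CS) (cartan_rho CS); set k := - C b i j.
  rewrite mulr1 subr0 => /plane_root_sigmaC.
  rewrite bE bji => /(plane_root_sigma CS RS ij); rewrite cij => h.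
  have {h} : plane i j (rho i a) (k - x) (y * k - 1).
    have xyk : x * (y * k) = 2 * k by rewrite mulrA xy.
    by move: h; congr plane; lia.
  move=> /plane_root_sigmaC; rewrite cji' => /(plane_sign RS ij).
  rewrite (_ : - - y * (k - x) - (y * k - 1) = -1); lia.
lia.
Qed.

Lemma rho_iter4 a (x y : nat) : C a i j = - x%:Z -> C a j i = - y%:Z -> 
  C (rho i a) j i = - y%:Z -> (x * y = 2)%N ->
  iter 4 (fun x => rho i (rho j x)) a = a.
Proof.
move=> cij cji cji' xy.
apply: (plane_rho_iter RS ij (l := [:: (1, 0); (0, 1); (x, 1); (1, y)]%N)).
  by rewrite /= !inE !xpair_eqE; nia.
have Rx1 : plane i j a x 1.
  have := plane_root_sigma CS RS ij (plane_root01 (rho i a)).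
  by rewrite (rhoK CS) (cartan_rho CS) cij; congr plane; lia.
have R1y : plane i j a 1 y.
  have := plane_root_sigmaC (plane_root10 RS i j (rho j a)).
  by rewrite (rhoK CS) (cartan_rho CS) cji; congr plane; lia.
move=> u w; rewrite !inE !xpair_eqE; split; last first.
  case/or4P=> /andP[/eqP-> /eqP->] //; [exact: (plane_root10 RS) | exact: plane_root01].
case: w => [|w] Ruw; first by have := plane_root_axis RS Ruw; lia.
case: u Ruw => [|u] Ruw; first by have := plane_root_axisC Ruw; lia.
have h1 := plane_root_sigma CS RS ij Ruw; have h2 := plane_root_sigmaC Ruw.
have h3 := plane_root_sigmaC h1.
have s1 := plane_sign RS ij h1; have s2 := plane_sign RS ij h2.
have s3 := plane_sign RS ij h3.
rewrite cij cji' in h1 s1 s3; rewrite cji in h2 s2.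
(* Reflecting along [i] and then [j] gives [(x w - u, w - y u)], now with [u] and [w] for the
   successors. The single reflections make the first entry nonnegative and the second nonpositive,
   so by (R1) one of them vanishes and a single reflection lands on an axis. *)
have [e|e] : (y * u.+1 = w.+1)%N \/ (x * w.+1 = u.+1)%N by nia.
  move: h2; rewrite (_ : _ - _ = 0); last by lia.
  by move=> /(plane_root_axis RS); nia.
move: h1; rewrite (_ : _ - _ = 0); last by lia.
by move=> /plane_root_axisC; nia.
Qed.
End RankTwo.

Section RankTwoA2.
Context {I : finType} {A : finType} {rho : I -> A -> A}.
Context {C : A -> I -> I -> int} {R : A -> vec I -> Prop}.
Hypothesis CS : cartan_scheme rho C.
Hypothesis RS : root_system rho C R.

(** [cartan_adj_ones] with [i] and [j] exchanged gives the entry at [rho i a]. Reflecting [(u, w)]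
    along [i] gives [(w - u, w)] and then along [j] gives [(w - u, - u)]; for positive coordinates
    the signs force [u = w], and (R2) then leaves only [(1, 1)]. *)
Lemma rho_iter3 (i j : I) a : i != j -> C a i j = -1 -> C a j i = -1 ->
  iter 3 (fun x => rho i (rho j x)) a = a.
Proof.
move=> ij cij cji; have ji : j != i by rewrite eq_sym.
have cji' := cartan_adj_ones CS RS ji cji cij.
apply: (plane_rho_iter RS ij (l := [:: (1, 0); (0, 1); (1, 1)]%N)) => // u w.
rewrite !inE !xpair_eqE; split; last first.
  case/or3P=> /andP[/eqP-> /eqP->].
  - exact: (plane_root10 RS).
  - exact: (plane_root01 RS).
  have := plane_root_sigma CS RS ij (plane_root01 RS i j (rho i a)).
  by rewrite (rhoK CS) (cartan_rho CS) cij.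
case: w => [|w] Ruw; first by have := plane_root_axis RS Ruw; lia.
case: u Ruw => [|u] Ruw; first by have := plane_root_axisC RS Ruw; lia.
have h1 := plane_root_sigma CS RS ij Ruw.
have s1 := plane_sign RS ij h1.
have s2 := plane_sign RS ij (plane_root_sigmaC CS RS ij h1).
rewrite cij cji' in h1 s1 s2.
move: h1; rewrite (_ : _ - _ = 0); last by lia.
by move=> /(plane_root_axisC RS); lia.
Qed.
End RankTwoA2.

(** * Arithmetic of two transpositions and the identity *)

(* For rho_i = (x y) and rho_j = (y z), (p, q, r, q, p, s) is the sequence of
   entries -c_ij, -c_ji met on the closed walk x, y, z, z, y, x: p at x and y
   (row i), q at y and z (row j), r at z (row i), s at x (row j). *)
Record path_entries (p q r s : int) : Prop := PathEntries {
  path_gt0 : 1 <= p /\ 1 <= q /\ 1 <= r /\ 1 <= s;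
  path_ps1 : p * s = 1 -> q = 1;
  path_qr1 : q * r = 1 -> p = 1;
  path_pq1 : p * q = 1 -> r = 1 /\ s = 1;
  path_ps2 : p * s <> 2;
  path_qr2 : q * r <> 2;
  path_pq2 : p * q = 2 -> r <> p /\ s <> q }.

Lemma path_entries_sym p q r s : path_entries p q r s -> path_entries q p s r.
Proof.
case=> h0 h1 h2 h3 h4 h5 h6; split=> //; rewrite 1?mulrC; first by lia.
- by case/h3.
- by case/h6.
Qed.

(** The nine alternatives arise by truncating [p] and [q] at 3. All but the first retain only lower
    bounds, which suffice for linear arithmetic. *)
Lemma path_entriesP p q r s : path_entries p q r s ->
  (p = 1 /\ q = 1 /\ r = 1 /\ s = 1) \/
  (2 <= p /\ 1 <= q /\ 3 <= r /\ 2 <= s) \/ (1 <= p /\ 2 <= q /\ 2 <= r /\ 3 <= s) \/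
  (3 <= p /\ 1 <= q /\ 3 <= r /\ 1 <= s) \/ (1 <= p /\ 3 <= q /\ 1 <= r /\ 3 <= s) \/
  (2 <= p /\ 3 <= q /\ 1 <= r /\ 2 <= s) \/ (3 <= p /\ 2 <= q /\ 2 <= r /\ 1 <= s) \/
  (3 <= p /\ 3 <= q /\ 1 <= r /\ 1 <= s) \/ (2 <= p /\ 2 <= q /\ 2 <= r /\ 2 <= s).
Proof.
case=> [[p1 [q1 [r1 s1]]]] h1 h2 h3 h4 h5 h6.
(* The product conditions are specialised to constants, which makes them linear. *)
have l1 : p = 1 -> s = 1 -> q = 1 by move=> ep es; apply: h1; rewrite ep es.
have l2 : q = 1 -> r = 1 -> p = 1 by move=> eq er; apply: h2; rewrite eq er.
have l3 : p = 1 -> q = 1 -> r = 1 /\ s = 1 by move=> ep eq; apply: h3; rewrite ep eq.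
have l4 : p = 1 -> s <> 2 by move=> ep es; apply: h4; rewrite ep es.
have l5 : p = 2 -> s <> 1 by move=> ep es; apply: h4; rewrite ep es.
have l6 : q = 1 -> r <> 2 by move=> eq er; apply: h5; rewrite eq er.
have l7 : q = 2 -> r <> 1 by move=> eq er; apply: h5; rewrite eq er.
clear h1 h2 h3 h4 h5 h6.
have [ep|[ep|ep]] : p = 1 \/ p = 2 \/ 3 <= p by lia.
- have [eq|[eq|eq]] : q = 1 \/ q = 2 \/ 3 <= q by lia.
  + by left; lia.
  + by do 2!right; left; lia.
  + by do 4!right; left; lia.
- have [eq|[eq|eq]] : q = 1 \/ q = 2 \/ 3 <= q by lia.
  + by right; left; lia.
  + by do 8!right; lia.
  + by do 5!right; left; lia.
- have [eq|[eq|eq]] : q = 1 \/ q = 2 \/ 3 <= q by lia.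
  + by do 3!right; left; lia.
  + by do 6!right; left; lia.
  + by do 7!right; left; lia.
Qed.

(* Here rho_i = (x y), rho_j = (y z), rho_k = id.  The entries -c_ik are P (at x
   and y) and R (at z), the entries -c_jk are Q (at y and z) and S (at x), and
   those of row k are tx, ty, tz (column i) and ux, uy, uz (column j).  The
   coordinates of V x, V y, V z are (v1, v2, v3), (w1, v2, v3), (w1, w2, v3). *)
Record chain_data (p q r s P Q R S tx ty tz ux uy uz v1 w1 v2 w2 v3 : int) : Prop :=
  ChainData {
    chain_path : path_entries p q r s;
    chain_ge0 : (0 <= P /\ 0 <= Q /\ 0 <= R /\ 0 <= S) /\
                (0 <= tx /\ 0 <= ty /\ 0 <= tz) /\ (0 <= ux /\ 0 <= uy /\ 0 <= uz);
    chain_eq0 : ((P = 0 <-> tx = 0) /\ (P = 0 <-> ty = 0) /\ (R = 0 <-> tz = 0)) /\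
                ((S = 0 <-> ux = 0) /\ (Q = 0 <-> uy = 0) /\ (Q = 0 <-> uz = 0));
    chain_P : P * tx <> 1 /\ P * ty <> 1 /\ (P * tx = 2 -> tx = ty) /\ (P * ty = 2 -> tx = ty);
    chain_Q : Q * uz <> 1 /\ Q * uy <> 1 /\ (Q * uz = 2 -> uz = uy) /\ (Q * uy = 2 -> uz = uy);
    chain_gt0 : (1 <= v1 /\ 1 <= w1 /\ 1 <= v2 /\ 1 <= w2) /\ 1 <= v3;
    chain_eqs : (v1 + w1 = 2 + p * v2 + P * v3 /\ v2 + w2 = 2 + q * w1 + Q * v3) /\
                (2 * w1 = 2 + r * w2 + R * v3 /\ 2 * v2 = 2 + s * v1 + S * v3);
    chain_eqs3 : 2 * v3 = 2 + tx * v1 + ux * v2 /\ 2 * v3 = 2 + ty * w1 + uy * v2 /\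
                 2 * v3 = 2 + tz * w1 + uz * w2 }.

(** Reversing the chain exchanges [i] with [j] and [x] with [z]. *)
Lemma chain_data_sym p q r s P Q R S tx ty tz ux uy uz v1 w1 v2 w2 v3 :
  chain_data p q r s P Q R S tx ty tz ux uy uz v1 w1 v2 w2 v3 ->
  chain_data q p s r Q P S R uz uy ux tz ty tx w2 v2 w1 v1 v3.
Proof.
case=> /path_entries_sym h1 h2 h3 h4 h5 h6 [[e1 e2] [e3 e4]] [f1 [f2 f3]].
split=> //; try tauto; repeat split=> //.
- by rewrite addrC e2.
- by rewrite addrC e1.
- by rewrite f3 addrAC.
- by rewrite f2 addrAC.
- by rewrite f1 addrAC.
Qed.

Lemma mul_lb (k m x : int) : k <= m -> 1 <= x -> k * x <= m * x.
Proof. nia. Qed.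

(** The bounds are multiplied by positive unknowns so that the products in the equations for [V]
    become atoms with linear lower bounds. *)
Lemma path_entries_mul p q r s (v w x y : int) : path_entries p q r s ->
  1 <= v -> 1 <= w -> 1 <= x -> 1 <= y ->
  (p = 1 /\ q = 1 /\ r = 1 /\ s = 1) \/
  (2 * v <= p * v /\ 1 * w <= q * w /\ 3 * x <= r * x /\ 2 * y <= s * y) \/
  (1 * v <= p * v /\ 2 * w <= q * w /\ 2 * x <= r * x /\ 3 * y <= s * y) \/
  (3 * v <= p * v /\ 1 * w <= q * w /\ 3 * x <= r * x /\ 1 * y <= s * y) \/
  (1 * v <= p * v /\ 3 * w <= q * w /\ 1 * x <= r * x /\ 3 * y <= s * y) \/
  (2 * v <= p * v /\ 3 * w <= q * w /\ 1 * x <= r * x /\ 2 * y <= s * y) \/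
  (3 * v <= p * v /\ 2 * w <= q * w /\ 2 * x <= r * x /\ 1 * y <= s * y) \/
  (3 * v <= p * v /\ 3 * w <= q * w /\ 1 * x <= r * x /\ 1 * y <= s * y) \/
  (2 * v <= p * v /\ 2 * w <= q * w /\ 2 * x <= r * x /\ 2 * y <= s * y).
Proof.
by move=> /path_entriesP path v1 w1 x1 y1; intuition (auto using mul_lb).
Qed.

Lemma mul_ge (m x : int) : 1 <= m -> 1 <= x -> x <= m * x.
Proof. nia. Qed.

Lemma mul_nneg (m x : int) : 0 <= m -> 1 <= x -> 0 <= m * x.
Proof. nia. Qed.

Lemma eq0_or_ge1 (m : int) : 0 <= m -> m = 0 \/ 1 <= m.
Proof. lia. Qed.

(** Ten of the sixteen zero patterns of [P, Q, R, S] contradict the equations once every nonzero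
    entry, together with its transpose, is bounded below by 1. *)
Lemma chain_patterns p q r s P Q R S tx ty tz ux uy uz v1 w1 v2 w2 v3 :
  chain_data p q r s P Q R S tx ty tz ux uy uz v1 w1 v2 w2 v3 ->
  (P = 0 /\ Q = 0 /\ R = 0 /\ S = 0) \/
  (P = 0 /\ R = 0 /\ 1 <= Q /\ 1 <= S) \/ (Q = 0 /\ S = 0 /\ 1 <= P /\ 1 <= R) \/
  (P = 0 /\ 1 <= R /\ 1 <= Q /\ 1 <= S) \/ (Q = 0 /\ 1 <= S /\ 1 <= P /\ 1 <= R) \/
  (R = 0 /\ S = 0 /\ 1 <= P /\ 1 <= Q).
Proof.
case=> [[[p1 [q1 [r1 s1]]] _ _ _ _ _ _]] [[P0 [Q0 [R0 S0]]]].
case=> [[tx0 [ty0 tz0]] [ux0 [uy0 uz0]]] [hP hQ] _ _.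
case=> [[v1g [w1g [v2g w2g]]] v3g] [[E1 E2] [E3 E4]] [F1 [F2 F3]].
have := mul_lb p1 v2g; have := mul_lb q1 w1g; have := mul_lb r1 w2g.
have := mul_lb s1 v1g; rewrite !mul1r => m1 m2 m3 m4.
have t1 := mul_nneg tx0 v1g; have t2 := mul_nneg ty0 w1g; have t3 := mul_nneg tz0 w1g.
have u1 := mul_nneg ux0 v2g; have u2 := mul_nneg uy0 v2g; have u3 := mul_nneg uz0 w2g.
have pos (m k x : int) : (m = 0 <-> k = 0) -> 1 <= m -> 0 <= k -> 1 <= x -> x <= k * x.
  by move=> mk mg k0 xg; apply: mul_ge => //; clear -mk mg k0; lia.
case: hP hQ => hPx [hPy hRz] [hSx [hQy hQz]].
have [zP|nzP] := eq0_or_ge1 P0; last first.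
all: have [zQ|nzQ] := eq0_or_ge1 Q0; last first.
all: have [zR|nzR] := eq0_or_ge1 R0; last first.
all: have [zS|nzS] := eq0_or_ge1 S0; last first.
(* This closes the six surviving patterns; the remaining goals are contradictory. *)
all: try by tauto.
all: exfalso.
(* Each [try] succeeds exactly in the goals where the entry concerned is nonzero; the rewrites below
   treat the zero entries. *)
all: try have := pos _ _ _ hPx nzP tx0 v1g; try have := pos _ _ _ hPy nzP ty0 w1g.
all: try have := pos _ _ _ hRz nzR tz0 w1g; try have := pos _ _ _ hSx nzS ux0 v2g.
all: try have := pos _ _ _ hQy nzQ uy0 v2g; try have := pos _ _ _ hQz nzQ uz0 w2g.
all: try have := mul_ge nzP v3g; try have := mul_ge nzQ v3g.
all: try have := mul_ge nzR v3g; try have := mul_ge nzS v3g.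
all: try rewrite (hPx.1 zP) in F1; try rewrite (hPy.1 zP) in F2.
all: try rewrite (hRz.1 zR) in F3; try rewrite (hSx.1 zS) in F1.
all: try rewrite (hQy.1 zQ) in F2; try rewrite (hQz.1 zQ) in F3.
all: rewrite ?(zP, zQ, zR, zS) ?mul0r in E1 E2 E3 E4.
all: clear pos hPx hPy hRz hSx hQy hQz.
all: lia.
Qed.

(** If [p, q, r, s] are all 1, the equations force [P = Q = 1], hence [ty] and [uy] are at least 2
    by [chain_P] and [chain_Q], which is too large. The other alternatives fail linearly. *)
Lemma chain_pattern_cross p q r s P Q R S tx ty tz ux uy uz v1 w1 v2 w2 v3 :
  chain_data p q r s P Q R S tx ty tz ux uy uz v1 w1 v2 w2 v3 ->
  R = 0 -> S = 0 -> 1 <= P -> 1 <= Q -> False.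
Proof.
case=> path [_ [[_ [ty0 _]] [_ [uy0 _]]]] [[_ [hPy _]] [_ [hQy _]]].
move=> [_ [Pty _]] [_ [Quy _]] [[v1g [w1g [v2g w2g]]] v3g] [[E1 E2] [E3 E4]] [F1 [F2 F3]].
move=> R0 S0 P1 Q1; rewrite R0 S0 ?mul0r ?addr0 in E3 E4.
have ty1 : 1 <= ty by clear -hPy ty0 P1; lia.
have uy1 : 1 <= uy by clear -hQy uy0 Q1; lia.
have m1 := mul_ge ty1 w1g; have m2 := mul_ge uy1 v2g.
have m3 := mul_ge P1 v3g; have m4 := mul_ge Q1 v3g.
case: (path_entries_mul path v2g w1g w2g v1g) => [[ep [eq [er es]]]|cases].
  subst p q r s; rewrite !mul1r in E1 E2 E3 E4.
  have P2 : P < 2 by clear -E1 E3 E4 F2 m1 m2 P1 v3g; nia.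
  have Q2 : Q < 2 by clear -E2 E3 E4 F2 m1 m2 Q1 v3g; nia.
  have {P1 P2} eP : P = 1 by lia.
  have {Q1 Q2} eQ : Q = 1 by lia.
  subst P Q; rewrite !mul1r in Pty Quy E1 E2.
  have := mul_lb (_ : 2 <= ty) w1g; have := mul_lb (_ : 2 <= uy) v2g.
  by clear m1 m2 m3 m4; lia.
clear hPy hQy Pty Quy.
by case: cases => [|[|[|[|[|[|[|]]]]]]]; lia.
Qed.

(** Here the diagram at [z] is a triangle. *)
Lemma chain_pattern_triangle p q r s P Q R S tx ty tz ux uy uz v1 w1 v2 w2 v3 :
  chain_data p q r s P Q R S tx ty tz ux uy uz v1 w1 v2 w2 v3 ->
  P = 0 -> 1 <= R -> 1 <= Q -> 1 <= S -> False.
Proof.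
case=> path [_ [[_ [_ tz0]] [ux0 [uy0 uz0]]]] [[hPx [hPy hRz]] [hSx [hQy hQz]]].
move=> _ [_ [Quy _]] [[v1g [w1g [v2g w2g]]] v3g] [[E1 E2] [E3 E4]] [F1 [F2 F3]].
move=> P0 R1 Q1 S1; rewrite P0 mul0r addr0 in E1.
rewrite (hPx.1 P0) mul0r addr0 in F1; rewrite (hPy.1 P0) mul0r addr0 in F2.
have tz1 : 1 <= tz by clear -hRz tz0 R1; lia.
have ux1 : 1 <= ux by clear -hSx ux0 S1; lia.
have uy1 : 1 <= uy by clear -hQy uy0 Q1; lia.
have uz1 : 1 <= uz by clear -hQz uz0 Q1; lia.
clear hPx hPy hRz hSx hQy hQz.
have m1 := mul_ge tz1 w1g; have m2 := mul_ge uz1 w2g; have m2' := mul_ge uy1 v2g.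
have m2'' := mul_ge ux1 v2g.
have m3 := mul_ge R1 v3g; have m4 := mul_ge Q1 v3g; have m5 := mul_ge S1 v3g.
case: (path_entries_mul path v2g w1g w2g v1g) => [[ep [eq [er es]]]|cases].
  subst p q r s; rewrite !mul1r in E1 E2 E3 E4.
  have eS : S = Q + R.
    have e : S * v3 = (Q + R) * v3 by rewrite mulrDl; clear -E1 E2 E3 E4; lia.
    by apply: (mulIf _ e); clear -v3g; lia.
  have eu : ux = uy.
    have e : ux * v2 = uy * v2 by clear -F1 F2; lia.
    by apply: (mulIf _ e); clear -v2g; lia.
  subst ux S.
  (* Eliminating [v3] from twice the equation [E4] by [F1] leaves a positive right-hand side, so
     [(Q + R) * uy] is less than 4. *)
  have e : (4 - (Q + R) * uy) * v2 = 4 + 2 * v1 + 2 * (Q + R).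
    have : 2 * (2 * v2) = 4 + 2 * v1 + (Q + R) * (2 * v3) by clear -E4; lia.
    by rewrite F1; clear; lia.
  have lt4 : (Q + R) * uy < 4.
    by clear -e v1g Q1 R1 v2g; nia.
  have uyE : uy = 1 by clear -lt4 uy1 Q1 R1; nia.
  subst uy; rewrite mulr1 in lt4 Quy; rewrite !mul1r in F1 F2.
  have eQ : Q = 2 by clear -lt4 Quy Q1 R1; lia.
  have eR : R = 1 by clear -lt4 eQ R1; lia.
  by subst Q R; clear Quy lt4; lia.
by case: cases => [|[|[|[|[|[|[|]]]]]]]; clear -E1 E2 E3 E4 F1 F2 F3
   v1g w1g v2g w2g v3g m1 m2 m2' m2'' m3 m4 m5; lia.
Qed.

(** The diagram is a path with middle vertex [j]. Eliminating [v3] bounds [Q * uy] by 3; the value 1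
    is excluded by [chain_Q], the value 3 by the equations, and 2 gives the two orientations of a
    double bond. *)
Lemma chain_pattern_path p q r s P Q R S tx ty tz ux uy uz v1 w1 v2 w2 v3 :
  chain_data p q r s P Q R S tx ty tz ux uy uz v1 w1 v2 w2 v3 ->
  P = 0 -> R = 0 -> 1 <= Q -> 1 <= S ->
  (p = 1 /\ q = 1 /\ r = 1 /\ s = 1) /\ (tx = 0 /\ ty = 0 /\ tz = 0) /\
  (S = Q /\ ux = uy /\ uz = uy) /\ ((Q = 1 /\ uy = 2) \/ (Q = 2 /\ uy = 1)).
Proof.
case=> path [_ [_ [ux0 [uy0 uz0]]]] [[hPx [hPy hRz]] [hSx [hQy hQz]]].
move=> _ [Quz [Quy [Quz2 Quy2]]].
move=> [[v1g [w1g [v2g w2g]]] v3g] [[E1 E2] [E3 E4]] [F1 [F2 F3]].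
move=> P0 R0 Q1 S1; rewrite P0 mul0r addr0 in E1; rewrite R0 mul0r addr0 in E3.
rewrite (hPx.1 P0) mul0r addr0 in F1; rewrite (hPy.1 P0) mul0r addr0 in F2.
rewrite (hRz.1 R0) mul0r addr0 in F3.
have ux1 : 1 <= ux by clear -hSx ux0 S1; lia.
have uy1 : 1 <= uy by clear -hQy uy0 Q1; lia.
have uz1 : 1 <= uz by clear -hQz uz0 Q1; lia.
have ts : tx = 0 /\ ty = 0 /\ tz = 0 by clear -hPx hPy hRz P0 R0; tauto.
clear hPx hPy hRz hSx hQy hQz.
have m2 := mul_ge uz1 w2g; have m2' := mul_ge uy1 v2g.
have m2'' := mul_ge ux1 v2g.
have m4 := mul_ge Q1 v3g; have m5 := mul_ge S1 v3g.
have eu : ux = uy.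
  have e : ux * v2 = uy * v2 by clear -F1 F2; lia.
  by apply: (mulIf _ e); clear -v2g; lia.
subst ux; case: (path_entries_mul path v2g w1g w2g v1g) => [[ep [eq [er es]]]|cases].
  subst p q r s; rewrite !mul1r in E1 E2 E3 E4.
  have eS : S = Q.
    have e : S * v3 = Q * v3 by clear -E1 E2 E3 E4; lia.
    by apply: (mulIf _ e); clear -v3g; lia.
  subst S.
  have e : (4 - Q * uy) * v2 = 4 + 2 * v1 + 2 * Q.
    have : 2 * (2 * v2) = 4 + 2 * v1 + Q * (2 * v3) by clear -E4; lia.
    by rewrite F1; clear; lia.
  have lt4 : Q * uy < 4 by clear -e v1g Q1 v2g; nia.
  have Q3 : Q <= 3 by clear -lt4 Q1 uy1; nia.
  split=> //; split=> //.
  have [eQ|[eQ|eQ]] : Q = 1 \/ Q = 2 \/ Q = 3 by clear -Q1 Q3; lia.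
  - subst Q; rewrite !mul1r in lt4 Quy Quz Quy2 Quz2 E2 E4.
    have [uy2|uy3] : uy = 2 \/ uy = 3 by clear -Quy lt4 uy1; lia.
      by have := Quy2 uy2; split; [split | left].
    (* The value 1 of [uz] is excluded by [Quz], and 2 would force [uz = uy] by [Quz2]. *)
    have uz3 : 3 <= uz by clear -Quz Quz2 uz1 uy3; lia.
    by have := mul_lb uz3 w2g; clear Quy2 Quz2; subst uy; lia.
  - subst Q; have uyE : uy = 1 by clear -lt4 uy1; lia.
    by subst uy; split; [split=> //; split=> //; apply: Quy2 | right].
  - subst Q; have uyE : uy = 1 by clear -lt4 uy1; lia.
    by subst uy; clear Quy2 Quz2; lia.
(* Since [Q * uy] is not 1, one factor is at least 2; this extra bound makes each of the eight
   remaining alternatives linearly inconsistent. *)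
exfalso; have [Q2|uy2] : 2 <= Q \/ 2 <= uy by clear -Q1 uy1 Quy; nia.
- have m6 := mul_lb Q2 v3g.
  by case: cases => [|[|[|[|[|[|[|]]]]]]]; clear -E1 E2 E3 E4 F1 F2 F3
   v1g w1g v2g w2g v3g m2 m2' m2'' m4 m5 m6; lia.
- have m6 := mul_lb uy2 v2g.
  by case: cases => [|[|[|[|[|[|[|]]]]]]]; clear -E1 E2 E3 E4 F1 F2 F3
   v1g w1g v2g w2g v3g m2 m2' m2'' m4 m5 m6; lia.
Qed.

(** * Involutions acting transitively on three points *)

Lemma card3_mem (T : finType) (a b c d : T) :
  #|T| = 3%N -> uniq [:: a; b; c] -> d \in [:: a; b; c].
Proof.
move=> T3 u; have /subset_cardP/(_ (subset_predT _)) -> // : #|[:: a; b; c]| = #|T|.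
by rewrite T3 (card_uniqP u).
Qed.

Lemma card3_ex (T : finType) (a b : T) :
  #|T| = 3%N -> a != b -> exists c, uniq [:: a; b; c].
Proof.
move=> T3 ab; case: (pickP [pred c | c \notin [:: a; b]]) => [c|no].
  rewrite !inE negb_or ![c == _]eq_sym => /andP[ca cb].
  by exists c; rewrite /= !inE negb_or ab ca cb.
have : (#|T| <= #|[:: a; b]|)%N.
  by apply/subset_leq_card/subsetP => c _; have := no c => /= /negbFE.
by move/leq_trans/(_ (card_size _)); rewrite T3.
Qed.

Lemma sum_ord3 (i j k : 'I_3) (F : 'I_3 -> int) :
  uniq [:: i; j; k] -> \sum_l F l = F i + F j + F k.
Proof.
move=> u; have : \sum_(l <- [:: i; j; k]) F l = \sum_(l in [:: i; j; k]) F l.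
  by rewrite big_uniq.
rewrite !big_cons big_nil addr0 addrA => ->.
by apply: eq_bigl => l; rewrite (card3_mem _ (card_ord 3) u).
Qed.

Definition swaps (T : Type) (f : T -> T) (a b c : T) : Prop :=
  f a = b /\ f b = a /\ f c = c.

Section Configurations.
Variables (I : finType) (T : finType) (rho : I -> T -> T).
Hypothesis rhoK : forall i, involutive (rho i).
Hypothesis T3 : #|T| = 3%N.

Lemma involution_cases i (x y z : T) : uniq [:: x; y; z] ->
  [\/ forall t, rho i t = t, swaps (rho i) x y z, swaps (rho i) y z x |
      swaps (rho i) x z y].
Proof.
move=> u; have E t := card3_mem t T3 u.
have inj : injective (rho i) := can_inj (rhoK i).
move: (u); rewrite /= !inE negb_or andbT => /andP[/andP[/eqP xy /eqP xz] /eqP yz].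
have := E (rho i x); rewrite !inE => /or3P[] /eqP ex.
- have := E (rho i y); rewrite !inE => /or3P[] /eqP ey.
  + by case: xy; apply: inj; rewrite ex ey.
  + have := E (rho i z); rewrite !inE => /or3P[] /eqP ez.
    * by case: xz; apply: inj; rewrite ex ez.
    * by case: yz; apply: inj; rewrite ey ez.
    * by apply: Or41 => t; have := E t; rewrite !inE => /or3P[] /eqP->.
  + by apply: Or43; split=> //; rewrite -ey rhoK.
- have ey : rho i y = x by rewrite -ex rhoK.
  apply: Or42; split=> //; split=> //.
  have := E (rho i z); rewrite !inE => /or3P[] /eqP ez //.
  + by case: yz; apply: inj; rewrite ey ez.
  + by case: xz; apply: inj; rewrite ex ez.
- have ez : rho i z = x by rewrite -ex rhoK.
  apply: Or44; split=> //; split=> //.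
  have := E (rho i y); rewrite !inE => /or3P[] /eqP ey //.
  + by case: yz; apply: inj; rewrite ey ez.
  + by case: xy; apply: inj; rewrite ex ey.
Qed.

(** A point fixed by every [rho i] would be its own orbit. *)
Lemma connected_moves : connected rho -> forall a, exists i, rho i a != a.
Proof.
move=> conn a; apply/existsP; apply: contraT => /existsPn fixa.
have all_a b : b = a.
  have [w <-] := conn a b; elim: w => //= i w ->.
  by have := fixa i; rewrite negbK => /eqP.
suff : #|T| = 1%N by rewrite T3.
by rewrite (eq_card (B := pred1 a)) ?card1 // => b; rewrite !inE (all_a b) eqxx.
Qed.

Lemma connected_chain : connected rho -> exists i j x y z,
  uniq [:: x; y; z] /\ swaps (rho i) x y z /\ swaps (rho j) y z x.
Proof.
move=> conn; have [a _] : exists a : T, true.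
  by case: (pickP (pred_of_simpl (@predT T))) => [a|] ; [exists a | move=> /eq_card0; rewrite T3].
have [i ia] := connected_moves conn a.
rewrite eq_sym in ia; have [c u] := card3_ex T3 ia.
have [j jc] := connected_moves conn c.
have si : swaps (rho i) a (rho i a) c.
  case: (involution_cases i u) => [fix_i|//|[_ [_ e3]]|[e1 _]].
  - by move: ia; rewrite fix_i eqxx.
  - by move: ia; rewrite e3 eqxx.
  - by move: u; rewrite -e1 /= !inE eqxx andbF.
(* [rho i] fixes [c] and [rho j] moves it, either to [rho i a] or to [a]; the image of [c] becomes
   the middle point of the chain. *)
case: (involution_cases j u) => [fix_j|[_ [_ e3]]|sj|sj].
- by move: jc; rewrite fix_j eqxx.
- by move: jc; rewrite e3 eqxx.
- by exists i, j, a, (rho i a), c.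
exists i, j, (rho i a), a, c; split; last by case: si => ? [? ?].
move: u; rewrite /= !inE !negb_or [a == rho i a]eq_sym; by case/and3P=> /andP[-> ->] -> _.
Qed.
End Configurations.

(** * Rank-two conditions on the Cartan entries *)

Section Pairs.
Context {I : finType} {A : finType} {rho : I -> A -> A}.
Context {C : A -> I -> I -> int} {R : A -> vec I -> Prop}.
Hypothesis CS : cartan_scheme rho C.
Hypothesis RS : root_system rho C R.
Variables i j : I.
Hypothesis ij : i != j.
Let ji : j != i. Proof. by rewrite eq_sym. Qed.

Lemma cartan_prod1 a : C a i j * C a j i = 1 -> C a i j = -1 /\ C a j i = -1.
Proof.
have := cartan_le0 CS a ij; have := cartan_le0 CS a ji.
move: (C a i j) (C a j i) => m n n0 m0 mn.
have m1 : m <= -1 by have : m <> 0 by [move=> e; rewrite e mul0r in mn]; lia.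
have n1 : n <= -1 by have : n <> 0 by [move=> e; rewrite e mulr0 in mn]; lia.
by split; nia.
Qed.

Lemma prod1_rho a : C a i j * C a j i = 1 ->
  C (rho j a) i j = -1 /\ iter 3 (fun x => rho i (rho j x)) a = a.
Proof.
by case/cartan_prod1=> ? ?; split; [apply: (cartan_adj_ones CS RS) | apply: (rho_iter3 CS RS)].
Qed.

Lemma prod2_rho a : C a i j * C a j i = 2 -> C (rho i a) j i = C a j i ->
  C (rho j a) i j = C a i j /\ iter 4 (fun x => rho i (rho j x)) a = a.
Proof.
have := cartan_le0 CS a ij; have := cartan_le0 CS a ji => cji cij prod e.
have [m em] : exists m : nat, C a i j = - m%:Z by exists `|C a i j|%N; lia.
have [n en] : exists n : nat, C a j i = - n%:Z by exists `|C a j i|%N; lia.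
rewrite en in e; have mn : m%:Z * n%:Z = 2 by rewrite -prod em en mulrNN.
split; first by rewrite em; apply: (cartan_adj_prod2 CS RS ij em en e mn).
by apply: (rho_iter4 CS RS ij em en e); lia.
Qed.

End Pairs.

Section SwapPairs.
Context {I : finType} {A : finType} {rho : I -> A -> A}.
Context {C : A -> I -> I -> int} {R : A -> vec I -> Prop}.
Hypothesis CS : cartan_scheme rho C.
Hypothesis RS : root_system rho C R.

(** With [rho j] trivial on the orbit of [a] under [rho i], the third power of [rho i \o rho j]
    moves [a], so product 1 is impossible. For product 2, [prod2_rho] with the indices exchanged
    applies since [rho j] fixes [a]. *)
Lemma swap_fix_pair i j a : i != j ->
  rho j a = a -> rho j (rho i a) = rho i a -> rho i a <> a ->
  C a i j * C a j i <> 1 /\ (C a i j * C a j i = 2 -> C (rho i a) j i = C a j i).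
Proof.
move=> ij ja jb ia; split=> [/(prod1_rho CS RS ij)[_]|].
  by rewrite /= ja jb (rhoK CS) ja.
have ji : j != i by rewrite eq_sym.
by rewrite mulrC => h; have [|-> _] := prod2_rho CS RS ji h; rewrite // ja.
Qed.

(** The composite of the two transpositions is a 3-cycle, so its second and fourth powers have no
    fixed point, which excludes $m_{ij}=2$ and $m_{ij}=4$. The equality of neighbouring entries that
    product 2 requires is automatic at [x] and [z], where one map fixes the point; at [y] it has to
    fail on both sides. *)
Lemma swap_path_entries i j x y z : i != j -> uniq [:: x; y; z] ->
  swaps (rho i) x y z -> swaps (rho j) y z x ->
  path_entries (- C y i j) (- C y j i) (- C z i j) (- C x j i).
Proof.
move=> ij u [ix [iy iz]] [jy [jz jx]]; have ji : j != i by rewrite eq_sym.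
move: u; rewrite /= !inE negb_or andbT => /andP[/andP[/eqP xy /eqP xz] /eqP yz].
have Cxij : C x i j = C y i j by rewrite -ix (cartan_rho CS).
have Czji : C z j i = C y j i by rewrite -jy (cartan_rho CS).
have nzx : C x i j <> 0.
  by move/(rho_iter2 CS RS ij); rewrite /= jx ix jy iz => /esym.
have nzz : C z i j <> 0.
  by move/(rho_iter2 CS RS ij); rewrite /= jz iy jx ix => /yz.
have nz a k l : C a k l <> 0 -> C a l k <> 0 by move=> h /(cartan_eq0 CS).
have := nz _ _ _ nzx; have := nz _ _ _ nzz => Czji0 Cxji0.
have le a := cartan_le0 CS a ij; have le' a := cartan_le0 CS a ji.
have := le y; have := le z; have := le' x; have := le' y => *.
split.
- by move: nzx nzz Cxji0 Czji0; rewrite Cxij Czji; lia.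
- rewrite mulrNN mulrC -Cxij => h; have [] := prod1_rho CS RS ji (a := x).
    by rewrite mulrC -h mulrC.
  by rewrite ix => ->.
- rewrite mulrNN -Czji mulrC => /(prod1_rho CS RS ij)[]; by rewrite jz => ->.
- rewrite mulrNN => h; have [e1 _] := prod1_rho CS RS ij h.
  rewrite mulrC in h; have [e2 _] := prod1_rho CS RS ji h.
  by rewrite -jy e1 -iy e2.
- rewrite mulrNN -Cxij mulrC => /(prod2_rho CS RS ji); rewrite jx => /(_ erefl)[_].
  by rewrite /= ix jy iz jz iy jx ix jy => /esym.
- rewrite mulrNN -Czji mulrC => /(prod2_rho CS RS ij); rewrite iz => /(_ erefl)[_].
  by rewrite /= jz iy jx ix jy iz jz iy.
- rewrite mulrNN => h; split=> /oppr_inj e.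
    rewrite mulrC in h; have := prod2_rho CS RS ji h.
    by rewrite jy => /(_ e)[_]; rewrite /= iy jx ix jy iz jz iy jx.
  have := prod2_rho CS RS ij h.
  by rewrite iy => /(_ e)[_]; rewrite /= jy iz jz iy jx ix jy iz => /esym.
Qed.
End SwapPairs.

(** * Rank three *)

Definition chain_swaps (T : eqType) (rho : 'I_3 -> T -> T) (i j k : 'I_3) (x y z : T) : Prop :=
  [/\ uniq [:: i; j; k], uniq [:: x; y; z], swaps (rho i) x y z & swaps (rho j) y z x].

(** The diagram is a path with middle vertex [j]; [(m, n)] equal to [(1, 1)], [(1, 2)], [(2, 1)]
    gives types $A_3$, $B_3$, $C_3$. *)
Definition chain_cartan (A : Type) (C : A -> 'I_3 -> 'I_3 -> int) (i j k : 'I_3)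
    (m n : int) : Prop :=
  forall a, (C a i j = -1 /\ C a j i = -1) /\ (C a i k = 0 /\ C a k i = 0) /\
            (C a j k = - m /\ C a k j = - n).

Lemma path_entries_ones p q r s : path_entries p q r s -> p * s = 1 ->
  p = 1 /\ q = 1 /\ r = 1 /\ s = 1.
Proof.
case=> [[p1 [q1 [r1 s1]]]] h _ hpq _ _ _ ps; have q_eq := h ps.
have p_eq : p = 1 by clear -p1 s1 ps; nia.
by have [|-> ->] := hpq; rewrite p_eq q_eq.
Qed.

(** This is the case where [rho i] and [rho k] are both [(x y)]. Unprimed path entries belong to
    [(i, j)], primed ones to [(k, j)]; [e] and [e'] are $-c_{ik}$ and $-c_{ki}$ at [x] and [y], and
    [E] is $-c_{ik}$ at [z]. The unknowns [a, b, c] are the coordinates of [V x], and [d] is the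
    [j]-coordinate of [V z]. A triangle is impossible, so [e = 0]; elimination then gives
    [p * s + p' * s' < 4], and as neither product is 2, both are 1. *)
Lemma fork_arith (p q r s p' q' r' s' e e' E a b c d : int) :
  path_entries p q r s -> path_entries p' q' r' s' ->
  0 <= e -> 0 <= e' -> (e = 0 -> e' = 0) -> (e' = 0 -> e = 0) -> 0 <= E ->
  1 <= a -> 1 <= b -> 1 <= c ->
  a + a = 2 + p * b + e * c -> b + b = 2 + s * a + s' * c ->
  c + c = 2 + e' * a + p' * b -> b + d = 2 + q * a + q' * c ->
  a + a = 2 + r * d + E * c ->
  (p = 1 /\ q = 1 /\ r = 1 /\ s = 1) /\ (p' = 1 /\ q' = 1 /\ r' = 1 /\ s' = 1) /\
  e = 0 /\ E = 0.
Proof.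
move=> path1 path2 e0 e0' ee' e'e E0 a1 b1 c1 eqa eqb eqc eqd eqE.
have [p1 [_ [_ s1]]] := path_gt0 path1; have [p1' [_ [_ s1']]] := path_gt0 path2.
have m1 := mul_ge p1 b1; have m2 := mul_ge s1 a1.
have m3 := mul_ge p1' b1; have m4 := mul_ge s1' c1.
have ez : e = 0.
  have [//|e1] := eq0_or_ge1 e0.
  have [/e'e//|e1'] := eq0_or_ge1 e0'.
  have := mul_ge e1 c1; have := mul_ge e1' a1; clear -m1 m2 m3 m4 eqa eqb eqc; lia.
have ez' := ee' ez; subst e e'.
have prod : (4 - (p * s + p' * s')) * b = 4 + 2 * s + 2 * s'.
  have : 2 * (b + b) = 4 + s * (a + a) + s' * (c + c) by clear -eqb; lia.
  by rewrite eqa eqc; clear; lia.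
have lt4 : p * s + p' * s' < 4 by clear -prod b1 s1 s1'; nia.
have ps : 1 <= p * s by clear -p1 s1; nia.
have ps' : 1 <= p' * s' by clear -p1' s1'; nia.
have ps2 := path_ps2 path1; have ps2' := path_ps2 path2.
have := path_entries_ones path1 _; have := path_entries_ones path2 _.
case=> [|p_eq [q_eq [r_eq s_eq]]]; first by clear -lt4 ps ps' ps2 ps2'; lia.
case=> [|p_eq' [q_eq' [r_eq' s_eq']]]; first by clear -lt4 ps ps' ps2 ps2'; lia.
subst; do !split=> //.
(* The coordinates [(a, b, c)] are [(3, 4, 3)], the sum of the positive roots of $A_3$; with [c]
   known, the equation for [E] is linear. *)
have c3 : c = 3 by clear -eqa eqb eqc; lia.
by subst c; clear -eqa eqb eqc eqd eqE; lia.
Qed.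

Section RankThree.
Context {A : finType} {rho : 'I_3 -> A -> A}.
Context {C : A -> 'I_3 -> 'I_3 -> int} {R : A -> vec 'I_3 -> Prop}.
Hypothesis CS : cartan_scheme rho C.
Hypothesis RS : root_system rho C R.

Section PosSum.
Context {V : A -> vec 'I_3}.
Hypothesis V_gt0 : forall a i, 1 <= V a i.
Hypothesis V_rho : forall a i, V (rho i a) = sigma C a i (V a) + alpha i *+ 2.

Lemma pos_sum_off a i l : i != l -> V (rho i a) l = V a l.
Proof. by move=> il; rewrite V_rho ffunE sigmaE ffunMnE alphaE (negbTE il) mul0r subr0 addr0. Qed.

Lemma pos_sum_eq i j k : uniq [:: i; j; k] -> forall a,
  V a i + V (rho i a) i = 2 + - C a i j * V a j + - C a i k * V a k.
Proof.
move=> u a; rewrite V_rho ffunE sigmaE ffunMnE alphaE eqxx (sum_ord3 _ u).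
rewrite (cartan_diag CS) mul1r; move: (V a i) (V a j) (V a k) => *; lia.
Qed.

(** Any two of the maps form a chain, so all six off-diagonal entries at [y] are at most -1. The
    reflected coordinates agree with those of [V y], and adding the three equations gives
    [2 S >= 6 + 2 S] for the coordinate sum [S]. *)
Lemma no_triangle i j k x y z : chain_swaps rho i j k x y z -> ~ swaps (rho k) x z y.
Proof.
case=> u uA si sj sk.
move: (u) (uA); rewrite /= !inE !negb_or !andbT => /andP[/andP[ij ik] jk].
move=> /andP[/andP[xy xz] yz].
have [ki kj] : k != i /\ k != j by split; rewrite eq_sym.
have ujki : uniq [:: j; k; i] by rewrite /= !inE !negb_or jk ki eq_sym ij.
have ukij : uniq [:: k; i; j] by rewrite /= !inE !negb_or ki kj ij.
have sk' : swaps (rho k) z x y by case: sk => ? [? ?].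
have uyzx : uniq [:: y; z; x] by rewrite /= !inE !negb_or yz eq_sym xy eq_sym xz.
have uzxy : uniq [:: z; x; y] by rewrite /= !inE !negb_or xy eq_sym xz eq_sym yz.
have [[p1 [q1 [_ _]]] _ _ _ _ _ _] := swap_path_entries CS RS ij uA si sj.
have [[p2 [_ [_ s2]]] _ _ _ _ _ _] := swap_path_entries CS RS jk uyzx sj sk'.
have [[_ [q3 [r3 _]]] _ _ _ _ _ _] := swap_path_entries CS RS ki uzxy sk' si.
have [ix [iy iz]] := si; have [jy [jz jx]] := sj; have [kx [kz ky]] := sk.
have ji : j != i by rewrite eq_sym.
rewrite -jy (cartan_rho CS) in p2; rewrite -iy (cartan_rho CS) in q3.
have Vxi : V x i = V y i by rewrite -kz pos_sum_off // -jy pos_sum_off.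
have Vxj : V z j = V y j by rewrite -kx pos_sum_off // -ix pos_sum_off.
have Vxk : V z k = V y k by rewrite -jy pos_sum_off.
have := pos_sum_eq u y; have := pos_sum_eq ujki y; have := pos_sum_eq ukij y.
rewrite iy jy ky Vxi Vxj.
have := mul_ge p1 (V_gt0 y j); have := mul_ge q1 (V_gt0 y i).
have := mul_ge p2 (V_gt0 y k); have := mul_ge s2 (V_gt0 y j).
have := mul_ge q3 (V_gt0 y k); have := mul_ge r3 (V_gt0 y i).
by clear; move: (V y i) (V y j) (V y k) => a b c; lia.
Qed.

Lemma fork_cartan i j k x y z : #|A| = 3%N -> chain_swaps rho i j k x y z -> swaps (rho k) x y z ->
  chain_cartan C i j k 1 1.
Proof.
move=> A3 [u uA si sj] sk.
move: (u) (uA); rewrite /= !inE !negb_or !andbT => /andP[/andP[ij ik] jk].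
move=> /andP[/andP[xy xz] yz].
have [ki kj] : k != i /\ k != j by split; rewrite eq_sym.
have ji : j != i by rewrite eq_sym.
have ujik : uniq [:: j; i; k] by rewrite /= !inE !negb_or ji jk ik.
have ukij : uniq [:: k; i; j] by rewrite /= !inE !negb_or ki kj ij.
have path1 := swap_path_entries CS RS ij uA si sj.
have path2 := swap_path_entries CS RS kj uA sk sj.
have [ix [iy iz]] := si; have [jy [jz jx]] := sj; have [kx [ky kz]] := sk.
have Cxi l : C x i l = C y i l by rewrite -ix (cartan_rho CS).
have Cxk l : C x k l = C y k l by rewrite -kx (cartan_rho CS).
have Czj l : C z j l = C y j l by rewrite -jy (cartan_rho CS).
have Vxi : V y i = V x i by rewrite -kx pos_sum_off.
have Vxj : V y j = V x j by rewrite -ix pos_sum_off.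
have Vxk : V y k = V x k by rewrite -ix pos_sum_off.
have Vzi : V z i = V x i by rewrite -Vxi -jy pos_sum_off.
have Vzk : V z k = V x k by rewrite -Vxk -jy pos_sum_off.
have := pos_sum_eq u x; have := pos_sum_eq ujik x; have := pos_sum_eq ukij x.
have := pos_sum_eq u z; have := pos_sum_eq ujik y.
rewrite ix iz jx jy kx Vxi Vxj Vxk Vzi Vzk !Cxi !Cxk => Ey Ez Ek Ej Ei.
have Cxik0 := cartan_le0 CS y ik; have Cxki0 := cartan_le0 CS y ki.
have nz : C y i k = 0 <-> C y k i = 0 by split; apply: cartan_eq0 CS _ _ _.
have nz' : C z i k = 0 -> C z k i = 0 by apply: cartan_eq0 CS _ _ _.
have nz'' : - C y i k = 0 -> - C y k i = 0 by clear -nz; lia.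
have nz3 : - C y k i = 0 -> - C y i k = 0 by clear -nz; lia.
have := fork_arith path1 path2 _ _ nz'' nz3 _ (V_gt0 x i) (V_gt0 x j) (V_gt0 x k) Ei Ej Ek Ey Ez.
rewrite !oppr_ge0 (cartan_le0 CS z ik) => /(_ Cxik0 Cxki0 isT).
move=> [[p_eq [q_eq [r_eq s_eq]]] [[p_eq' [q_eq' [r_eq' s_eq']]] [e_eq E_eq]]].
have zik : C z i k = 0 by clear -E_eq; lia.
have yik : C y i k = 0 by clear -e_eq; lia.
have := nz' zik; have := nz.1 yik => yki zki a.
have := card3_mem a A3 uA; rewrite !inE => /or3P[] /eqP->.
- by rewrite !Cxi !Cxk yik yki; clear -p_eq s_eq p_eq' s_eq'; lia.
- by rewrite yik yki; clear -p_eq q_eq p_eq' q_eq'; lia.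
- by rewrite !Czj zik zki; clear -r_eq q_eq r_eq' q_eq'; lia.
Qed.

(** As [rho k] is the identity, [swap_fix_pair] applies to [(i, k)] and [(j, k)], which yields the
    fields [chain_P] and [chain_Q]. *)
Lemma fixed_end_data i j k x y z : chain_swaps rho i j k x y z -> (forall a, rho k a = a) ->
  chain_data (- C y i j) (- C y j i) (- C z i j) (- C x j i)
    (- C y i k) (- C y j k) (- C z i k) (- C x j k)
    (- C x k i) (- C y k i) (- C z k i) (- C x k j) (- C y k j) (- C z k j)
    (V x i) (V y i) (V y j) (V z j) (V y k).
Proof.
move=> [u uA si sj] fk.
move: (u) (uA); rewrite /= !inE !negb_or !andbT => /andP[/andP[ij ik] jk].
move=> /andP[/andP[/eqP xy /eqP xz] /eqP yz].
have [ix [iy iz]] := si; have [jy [jz jx]] := sj.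
have Cxi l : C x i l = C y i l by rewrite -ix (cartan_rho CS).
have Czj l : C z j l = C y j l by rewrite -jy (cartan_rho CS).
have ji : j != i by rewrite eq_sym.
have ki : k != i by rewrite eq_sym.
have kj : k != j by rewrite eq_sym.
have ujik : uniq [:: j; i; k] by rewrite /= !inE !negb_or ji jk ik.
have ukij : uniq [:: k; i; j] by rewrite /= !inE !negb_or ki kj ij.
have Vzi : V z i = V y i by rewrite -jy pos_sum_off.
have Vxj : V x j = V y j by rewrite -ix pos_sum_off.
have Vxk : V x k = V y k by rewrite -ix pos_sum_off.
have Vzk : V z k = V y k by rewrite -jy pos_sum_off.
have iff0 a l m : C a l m = 0 <-> C a m l = 0.
  by split; apply: cartan_eq0 CS _ _ _.
split.
- exact: (swap_path_entries CS RS ij uA si sj).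
- have h a := (cartan_le0 CS a ik, cartan_le0 CS a jk, cartan_le0 CS a ki, cartan_le0 CS a kj).
  by rewrite !oppr_ge0 !h.
- have opp0 m n : (m = 0 <-> n = 0) -> (- m = 0 :> int <-> - n = 0 :> int).
    by clear; lia.
  split; (split; [|split]); apply: opp0;
    by [apply: iff0 | rewrite -Cxi; apply: iff0 | rewrite -Czj; apply: iff0].
- have [n1 e1] : C x i k * C x k i <> 1 /\ (C x i k * C x k i = 2 -> C (rho i x) k i = C x k i).
    by apply: (swap_fix_pair CS RS ik); rewrite ?fk // ix => /esym.
  have [n2 e2] : C y i k * C y k i <> 1 /\ (C y i k * C y k i = 2 -> C (rho i y) k i = C y k i).
    by apply: (swap_fix_pair CS RS ik); rewrite ?fk // iy.
  rewrite Cxi ix in n1 e1; rewrite iy in e2; rewrite !mulrNN.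
  by split=> //; split=> //; split=> [/e1|/e2] ->.
- have [n1 e1] : C z j k * C z k j <> 1 /\ (C z j k * C z k j = 2 -> C (rho j z) k j = C z k j).
    by apply: (swap_fix_pair CS RS jk); rewrite ?fk // jz.
  have [n2 e2] : C y j k * C y k j <> 1 /\ (C y j k * C y k j = 2 -> C (rho j y) k j = C y k j).
    by apply: (swap_fix_pair CS RS jk); rewrite ?fk // jy => /esym.
  rewrite Czj jz in n1 e1; rewrite jy in e2; rewrite !mulrNN.
  by split=> //; split=> //; split=> [/e1|/e2] ->.
- by rewrite !V_gt0.
- have := pos_sum_eq u x; have := pos_sum_eq ujik y; have := pos_sum_eq u z.
  have := pos_sum_eq ujik x; rewrite ix jy iz jx Vzi Vxj Vxk Vzk !Cxi => e4 e3 e2 e1.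
  by split; split=> //; rewrite mulr2n mulrDl !mul1r.
- have := pos_sum_eq ukij x; have := pos_sum_eq ukij y; have := pos_sum_eq ukij z.
  rewrite !fk Vzi Vxj Vxk Vzk => e3 e2 e1.
  by split=> //; [|split]; rewrite mulr2n mulrDl !mul1r.
Qed.
End PosSum.
End RankThree.

(** * Reversal of chains and classification in rank three *)

Lemma swapsC (T : Type) (f : T -> T) a b c : swaps f a b c -> swaps f b a c.
Proof. by case=> ? [? ?]. Qed.

Lemma chain_swapsC (T : eqType) (rho : 'I_3 -> T -> T) i j k x y z :
  chain_swaps rho i j k x y z -> chain_swaps rho j i k z y x.
Proof.
have rot (S : eqType) (a b c : S) : uniq [:: a; b; c] -> uniq [:: b; a; c].
  by rewrite /= !inE !negb_or [b == a]eq_sym => /and3P[/andP[-> ->] ->].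
case=> u uA si sj; split; [exact: rot | | exact: swapsC | exact: swapsC].
by rewrite -rev_uniq.
Qed.

Section Classification.
Context {A : finType} {rho : 'I_3 -> A -> A}.
Context {C : A -> 'I_3 -> 'I_3 -> int} {R : A -> vec 'I_3 -> Prop}.
Hypothesis CS : cartan_scheme rho C.
Hypothesis RS : root_system rho C R.
Hypothesis A3 : #|A| = 3%N.

(** The reflection along [k] negates the [k]-coordinate of a root and keeps the others. By (R1) a
    root with nonzero [k]-coordinate therefore has no other nonzero coordinate. *)
Lemma isolated_reducible i j k : uniq [:: i; j; k] ->
  (forall a, C a k i = 0 /\ C a k j = 0) -> reducible R.
Proof.
move=> u Ck; exists [set k], (~: [set k]); split.
- by apply/set0Pn; exists k; rewrite inE.
- apply/set0Pn; exists i; rewrite !inE; move: u; rewrite /= !inE negb_or.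
  by case/andP=> /andP[].
- by rewrite -setI_eq0 setICr.
- by rewrite setUCr.
move=> a v; split=> [Rv|[] []//].
have [vk|/eqP vk] := eqVneq (v k) 0.
  by right; split=> // l; rewrite !inE negbK => /eqP->.
left; split=> // l; rewrite inE => lk.
have [ck ck'] := Ck a.
have sl : sigma C a k v l = v l.
  by rewrite sigmaE eq_sym (negbTE lk) mul0r subr0.
have sk : sigma C a k v k = - v k.
  rewrite sigmaE eqxx (sum_ord3 _ u) ck ck' (cartan_diag CS).
  by move: (v k) (v i) (v j) => *; lia.
have sgn b w : R b w -> (forall l, 0 <= w l) \/ (forall l, w l <= 0).
  case/(root_sign RS)=> h; [left | right] => // m.
  by have := h m; rewrite ffunE oppr_ge0.
case: (sgn _ _ (root_sigma RS k Rv)) => hs; have := hs k; have := hs l;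
  case: (sgn _ _ Rv) => hv; have := hv k; have := hv l; rewrite sk sl; clear -vk;
  by move: (v k) (v l) vk => m n; lia.
Qed.

Lemma chain_cartan_intro i j k x y z m n : chain_swaps rho i j k x y z ->
  - C y i j = 1 /\ - C y j i = 1 /\ - C z i j = 1 /\ - C x j i = 1 ->
  - C x k i = 0 /\ - C y k i = 0 /\ - C z k i = 0 ->
  - C x j k = m /\ - C y j k = m ->
  - C x k j = n /\ - C y k j = n /\ - C z k j = n -> chain_cartan C i j k m n.
Proof.
case=> u uA [ix _] [jy _] [p1 [q1 [r1 s1]]] [tx [ty tz]] [S1 Q1] [ux [uy uz]] a.
have Cxi l : C x i l = C y i l by rewrite -ix (cartan_rho CS).
have Czj l : C z j l = C y j l by rewrite -jy (cartan_rho CS).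
have ik b : C b k i = 0 -> C b i k = 0 by apply: cartan_eq0 CS _ _ _.
have tx' : C x k i = 0 by lia.
have ty' : C y k i = 0 by lia.
have tz' : C z k i = 0 by lia.
have := card3_mem a A3 uA; rewrite !inE => /or3P[] /eqP->.
- by rewrite (ik _ tx') tx' Cxi; clear ik Cxi Czj; lia.
- by rewrite (ik _ ty') ty'; clear ik Cxi Czj; lia.
- by rewrite (ik _ tz') tz' Czj Czj; clear ik Cxi Czj; lia.
Qed.

Lemma rank3_classification : connected rho -> finite_rs R -> irreducible R ->
  exists i j k x y z, chain_swaps rho i j k x y z /\
    ((swaps (rho k) x y z /\ chain_cartan C i j k 1 1) \/
     ((forall a, rho k a = a) /\
      (chain_cartan C i j k 1 2 \/ chain_cartan C i j k 2 1))).
Proof.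
move=> conn fin irr; have [V [Vgt0 Vrho]] := pos_root_sum CS RS fin.
have [i [j [x [y [z [uA [si sj]]]]]]] := connected_chain (rhoK CS) A3 conn.
have ij : i != j.
  apply/eqP=> eij; case: si sj => _ [iy _] [jy _]; move: uA.
  by rewrite -iy eij jy /= !inE eqxx orbT.
have [k u] := card3_ex (card_ord 3) ij.
have ch : chain_swaps rho i j k x y z by [].
case: (involution_cases (rhoK CS) A3 k uA) => [fk|sk|sk|sk]; last first.
- by case: (no_triangle CS RS Vgt0 Vrho ch).
(* [rho k] agrees with [rho j], so the reversed chain puts the repeated transposition first. *)
- exists j, i, k, z, y, x; split; first exact: chain_swapsC.
  left; split; first exact: swapsC.
  by apply: (fork_cartan CS RS Vgt0 Vrho A3 (chain_swapsC ch)); apply: swapsC.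
- by exists i, j, k, x, y, z; split=> //; left; split=> //; apply: (fork_cartan CS RS Vgt0 Vrho A3 ch sk).
have D := fixed_end_data CS RS Vgt0 Vrho ch fk.
(* Stated for an arbitrary chain with end [k], since it serves both the given chain and its
   reversal. *)
have half i' j' x' y' z' (ch' : chain_swaps rho i' j' k x' y' z')
    (D' := fixed_end_data CS RS Vgt0 Vrho ch' fk) :
    - C y' i' k = 0 -> - C z' i' k = 0 -> 1 <= - C y' j' k -> 1 <= - C x' j' k ->
    chain_cartan C i' j' k 1 2 \/ chain_cartan C i' j' k 2 1.
  move=> P0 R0 Q1 S1.
  have [ones [ts [[SQ [ux uz]] mn]]] := chain_pattern_path D' P0 R0 Q1 S1.
  case: mn => -[eQ eu]; [left | right];
    exact: chain_cartan_intro ch' ones ts (conj (etrans SQ eQ) eQ)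
      (conj (etrans ux eu) (conj eu (etrans uz eu))).
case: (chain_patterns D) => [z4|[[P0 [R0 [Q1 S1]]]|[[Q0 [S0 [P1 R1]]]|[[P0 [R1 [Q1 S1]]]|
  [[Q0 [S1 [P1 R1]]]|[R0 [S0 [P1 Q1]]]]]]]].
- case: irr; apply: (isolated_reducible u) => a.
  have [_ _ [[hPx [hPy hRz]] [hSx [hQy hQz]]] _ _ _ _ _] := D.
  case: z4 => P0 [Q0 [R0 S0]].
  have := card3_mem a A3 uA; rewrite !inE => /or3P[] /eqP->; split; apply: oppr_inj;
  by rewrite oppr0; tauto.
- exists i, j, k, x, y, z; split=> //; right; split=> //; exact: half ch P0 R0 Q1 S1.
- have ch' := chain_swapsC ch; exists j, i, k, z, y, x; split=> //; right; split=> //.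
  exact: half ch' Q0 S0 P1 R1.
- by case: (chain_pattern_triangle D P0 R1 Q1 S1).
- by case: (chain_pattern_triangle (chain_data_sym D) Q0 S1 P1 R1).
- by case: (chain_pattern_cross D R0 S0 P1 Q1).
Qed.
End Classification.

(** * Types, indecomposability and the normalised labelling *)

Lemma ord3P (l : 'I_3) : [\/ l = i1, l = i2 | l = i3].
Proof.
have := @card3_mem _ i1 i2 i3 l (card_ord 3) isT.
by rewrite !inE => /or3P[] /eqP; [apply: Or31 | apply: Or32 | apply: Or33].
Qed.

Lemma chain_of_type (M : 'I_3 -> 'I_3 -> int) i j k m n : uniq [:: i; j; k] ->
  (forall l, M l l = 2) -> M i j = -1 /\ M j i = -1 -> M i k = 0 /\ M k i = 0 ->
  M j k = m /\ M k j = n -> of_type (cm3 (-1) (-1) m n) M.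
Proof.
move=> u diag [Mij Mji] [Mik Mki] [Mjk Mkj].
pose f l := if l == i then i1 else if l == j then i2 else i3.
move: (u); rewrite /= !inE negb_or andbT => /andP[/andP[ij ik] jk].
have fi : f i = i1 by rewrite /f eqxx.
have fj : f j = i2 by rewrite /f eq_sym (negbTE ij) eqxx.
have fk : f k = i3 by rewrite /f ![k == _]eq_sym (negbTE ik) (negbTE jk).
have mem l := card3_mem l (card_ord 3) u.
have f_inj : injective f.
  move=> l l'; have := mem l; have := mem l'.
  by rewrite !inE => /or3P[] /eqP-> /or3P[] /eqP->; rewrite ?fi ?fj ?fk.
exists (perm f_inj) => l l'; rewrite !permE.
have := mem l; have := mem l'.
by rewrite !inE => /or3P[] /eqP-> /or3P[] /eqP->; rewrite ?fi ?fj ?fk ?diag.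
Qed.

Lemma of_type_entry X M (l l' : 'I_3) : of_type X M -> exists t t', M t t' = X l l'.
Proof. by case=> p Mp; exists (p^-1 l)%g, (p^-1 l')%g; rewrite Mp !permKV. Qed.

(** The value -2 occurs in types $B_3$ and $C_3$ but not in $A_3$, which separates the cases of the
    final claim. *)
Lemma of_type_A3_entry M l l' : of_type cmA3 M -> M l l' <> -2.
Proof.
case=> p ->; move: (p l) (p l') => t t'.
by case: (ord3P t) => ->; case: (ord3P t') => ->.
Qed.

Lemma chain_standard (A : finType) (C : A -> 'I_3 -> 'I_3 -> int) i j k m n :
  uniq [:: i; j; k] -> (forall a l, C a l l = 2) -> chain_cartan C i j k m n -> standard C.
Proof.
move=> u diag ch a b; apply: functional_extensionality => l.
apply: functional_extensionality => l'.
have [[aij aji] [[aik aki] [ajk akj]]] := ch a.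
have [[bij bji] [[bik bki] [bjk bkj]]] := ch b.
have := card3_mem l (card_ord 3) u; have := card3_mem l' (card_ord 3) u.
by rewrite !inE => /or3P[] /eqP-> /or3P[] /eqP->;
  rewrite ?diag ?aij ?aji ?aik ?aki ?ajk ?akj ?bij ?bji ?bik ?bki ?bjk ?bkj.
Qed.

(** The block containing [j] must contain both neighbours of [j], hence everything. *)
Lemma path_indecomposable (M : 'I_3 -> 'I_3 -> int) i j k : uniq [:: i; j; k] ->
  M i j != 0 -> M j i != 0 -> M j k != 0 -> M k j != 0 -> indecomposable M.
Proof.
move=> u Mij Mji Mjk Mkj [I1 [I2 [I1n I2n dis cov M0]]].
have mem l := card3_mem l (card_ord 3) u.
have split l : l \in I1 \/ l \in I2.
  by apply/orP; rewrite -in_setU cov inE.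
have all1 (J : {set 'I_3}) : i \in J -> j \in J -> k \in J -> J = setT.
  by move=> ? ? ?; apply/setP=> l; have := mem l; rewrite !inE => /or3P[] /eqP->.
have nz l l' : M l l' != 0 -> l \in I1 -> l' \in I2 -> False.
  by move=> /eqP Ml l1 l2; apply/Ml/M0.
case: (split j) => jI.
- have I1T : I1 = setT.
    by apply: all1 => //; [case: (split i) | case: (split k)] => // h; case: (nz _ _ _ jI h).
  by move: dis I2n; rewrite I1T -setI_eq0 setTI => ->.
- have I2T : I2 = setT.
    by apply: all1 => //; [case: (split i) | case: (split k)] => // h; case: (nz _ _ _ h jI).
  by move: dis I1n; rewrite I2T -setI_eq0 setIT => ->.
Qed.

(** The middle vertex has nonzero entries with both others, so a zero entry between 1 and 3 forces
    it to be 2. *)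
Lemma chain_middle (A : Type) (C : A -> 'I_3 -> 'I_3 -> int) i j k m n a :
  uniq [:: i; j; k] -> chain_cartan C i j k m n -> m != 0 -> n != 0 ->
  C a i1 i3 = 0 -> j = i2 /\ (i = i1 /\ k = i3 \/ i = i3 /\ k = i1).
Proof.
move=> u /(_ a) [[aij aji] [_ [ajk akj]]] /eqP m0 /eqP n0.
move: u aij aji ajk akj.
case: (ord3P i) => ->; case: (ord3P j) => ->; case: (ord3P k) => -> //= _ c1 c2 c3 c4 c0;
  by [split=> //; left | split=> //; right | exfalso; lia].
Qed.

Theorem theorem6p3 (A : finType) (rho : 'I_3 -> A -> A)
    (C : A -> 'I_3 -> 'I_3 -> int) (R : A -> vec 'I_3 -> Prop) :
  cartan_scheme rho C -> connected rho -> #|A| = 3%N ->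
  root_system rho C R -> finite_rs R -> irreducible R ->
  standard C /\
  (forall a, indecomposable (C a) /\
     (of_type cmA3 (C a) \/ of_type cmB3 (C a) \/ of_type cmC3 (C a))) /\
  ((forall a, [/\ C a i1 i2 = -1, C a i2 i1 = -1, C a i1 i3 = 0 & C a i3 i1 = 0]) ->
   exists x y z : A,
     [/\ x != y, y != z, x != z &
       forall a, a = x \/ a = y \/ a = z] /\
     (of_type cmA3 (C x) ->
        [/\ rho i1 x = y /\ rho i1 y = x /\ rho i1 z = z,
            rho i3 x = y /\ rho i3 y = x /\ rho i3 z = z &
            rho i2 y = z /\ rho i2 z = y /\ rho i2 x = x]) /\
     (of_type cmB3 (C x) \/ of_type cmC3 (C x) ->
        [/\ rho i1 x = y /\ rho i1 y = x /\ rho i1 z = z,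
            rho i2 y = z /\ rho i2 z = y /\ rho i2 x = x &
            forall a, rho i3 a = a])).
Proof.
move=> CS conn A3 RS fin irr.
have [i [j [k [x [y [z [[u uA si sj] H]]]]]]] := rank3_classification CS RS A3 conn fin irr.
have diag := cartan_diag CS.
have [m [n [ch mn]]] : exists m n, chain_cartan C i j k m n /\
    (m = 1 /\ n = 1 \/ m = 1 /\ n = 2 \/ m = 2 /\ n = 1).
  case: H => [[_ ch]|[_ [ch|ch]]]; [exists 1, 1 | exists 1, 2 | exists 2, 1];
    by split=> //; lia.
have m0 : m != 0 by case: mn => [|[]] [-> _].
have n0 : n != 0 by case: mn => [|[]] [_ ->].
split; first exact: chain_standard u diag ch.
split=> [a|H13].
  have [cij [cik cjk]] := ch a; split.
    apply: (path_indecomposable u); rewrite ?cij.1 ?cij.2 ?cjk.1 ?cjk.2 ?oppr_eq0 //.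
  have T := chain_of_type u (diag a) cij cik cjk.
  case: mn T => [|[]] [-> ->] T; [by left | by right; left | by right; right].
exists x, y, z; split.
  move: (uA); rewrite /= !inE negb_or andbT => /andP[/andP[xy xz] yz]; split=> // a.
  by have := card3_mem a A3 uA; rewrite !inE => /or3P[] /eqP; tauto.
have [c12 c21 c13 c31] := H13 x.
have [jE ik] := chain_middle u ch m0 n0 c13; subst j.
case: H => [[sk ch1]|[fk chBC]].
- split=> [_|T].
    (* [rho i] and [rho k] act alike, so both orientations of the path give the required
       permutations. *)
    by case: ik si sk => -[-> ->] si sk; split.
  exfalso; have T3 : of_type cmA3 (C x).
    have [cij [cik cjk]] := ch1 x; exact: chain_of_type u (diag x) cij cik cjk.
  have [l [l' e]] : exists l l', C x l l' = -2.
    by case: T => T; [have := of_type_entry i3 i2 T | have := of_type_entry i2 i3 T].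
  exact: of_type_A3_entry T3 e.
- have [l [l' e]] : exists l l', C x l l' = -2.
    by case: chBC => /(_ x) [_ [_ [e1 e2]]]; [exists k, i2 | exists i2, k].
  split=> [T|_]; first by case: (of_type_A3_entry T e).
  case: ik => -[iE kE]; subst i k; first by split.
  (* With [k = i1] the double bond would join 1 and 2, against $c_{12}=c_{21}=-1$. *)
  by exfalso; case: chBC => /(_ x) [_ [_ [e1 e2]]]; move: c12 c21; rewrite ?e1 ?e2.
Qed.
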